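(* Let $T[1..n]$ be a string over the alphabet $[1..\sigma]$ and let $\Gamma$ be a string attractor of size $\gamma$ for $T$. For any integer parameter $\tau\ge 2$, one can store a data structure of $\mathcal{O}(\gamma\tau\log_\tau(n/\gamma))$ $w$-bit words supporting the extraction of any length-$\ell$ substring of $T$ in $\mathcal{O}(\log_\tau(n/\gamma)+\ell\log(\sigma)/w)$ time.
   Context: A string attractor of $T$ is a set $\Gamma\subseteq\{1,\dots,n\}$ such that every substring $T[i..j]$ has an occurrence $T[i'..j']=T[i..j]$ with $p\in[i',j']$ for some $p\in\Gamma$. The model is the word RAM with word size $w$ bits.
   Formalization: The bounds carry extra terms, γ words of space and 1 unit of time, as the literal ones fail when log_τ(n/γ) is near 0 (e.g. γ = n); it is also assumed that n ≥ 1, n < 2^w and σ ≤ 2^w, so that positions, lengths and characters fit in a word. *)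

(* Defs.v *)
From HB Require Import structures.
From mathcomp Require Import all_boot all_order all_algebra.
From mathcomp Require Import reals exp.

Set Implicit Arguments.
Unset Strict Implicit.
Unset Printing Implicit Defensive.

Import Order.TTheory GRing.Theory Num.Theory.

(* Text positions are 0-based: position p of T[1..n] is p - 1 : 'I_n, and the
   character c of [1..sigma] is c - 1 : 'I_sigma.  Both endpoints of a
   substring are included. *)
Definition substring (A : Type) (T : seq A) (i j : nat) : seq A :=
  take (j - i).+1 (drop i T).

Definition string_attractor (n : nat) (A : Type) (T : n.-tuple A)
    (Gamma : {set 'I_n}) : Prop :=
  forall i j : 'I_n, i <= j ->
    exists i' j' : 'I_n,
      [/\ i' <= j', substring T i' j' = substring T i j &
          exists2 p : 'I_n, p \in Gamma & i' <= p <= j'].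

(* Word RAM with w-bit words.  A program is a finite list of instructions that
   does not depend on w.  The machine has registers, a read-only memory holding
   the data structure, and a read-write working memory.  Every instruction
   costs one unit of time. *)
Inductive binop :=
  | OpAdd | OpSub | OpMul | OpDiv | OpMod
  | OpAnd | OpOr | OpXor | OpShl | OpShr
  | OpEq | OpLt.

Definition eval_binop (w : nat) (o : binop) (x y : nat) : nat :=
  match o with
  | OpAdd => (x + y) %% 2 ^ w
  | OpSub => (x + 2 ^ w - y) %% 2 ^ w
  | OpMul => (x * y) %% 2 ^ w
  | OpDiv => x %/ y
  | OpMod => x %% y
  | OpAnd => Nat.land x y
  | OpOr  => Nat.lor x y
  | OpXor => Nat.lxor x y
  | OpShl => (x * 2 ^ y) %% 2 ^ w
  | OpShr => x %/ 2 ^ y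
  | OpEq  => x == y
  | OpLt  => x < y
  end.

(* In the memory instructions, a is the register holding the index and k, d are
   constants of the program: the cell accessed is k * (register a) + d (scaled
   addressing with displacement).  The effective address is not reduced modulo
   2 ^ w, so the data structure may occupy O(2 ^ w) cells. *)
Inductive instr :=
  | Const of nat & nat                 (* Const r x     : r := x *)
  | Bin of binop & nat & nat & nat     (* Bin o r a b   : r := a o b *)
  | LoadDS of nat & nat & nat & nat    (* LoadDS r a k d : r := DS[k * a + d] *)
  | LoadM of nat & nat & nat & nat     (* LoadM r a k d : r := M[k * a + d] *)
  | Store of nat & nat & nat & nat     (* Store r a k d : M[k * a + d] := r *)
  | JumpIf of nat & nat.               (* JumpIf r q    : if r <> 0 goto q *)

Definition program := seq instr.

Record state := State
  { st_pc : nat; st_reg : nat -> nat; st_mem : nat -> nat }.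

Definition update (f : nat -> nat) (a v : nat) : nat -> nat :=
  fun x => if x == a then v else f x.

Definition exec (w : nat) (DS : seq nat) (ins : instr) (s : state) : state :=
  let r := st_reg s in
  let m := st_mem s in
  let next := (st_pc s).+1 in
  match ins with
  | Const x v => State next (update r x (v %% 2 ^ w)) m
  | Bin o x a b => State next (update r x (eval_binop w o (r a) (r b))) m
  | LoadDS x a k d => State next (update r x (nth 0 DS (k * r a + d))) m
  | LoadM x a k d => State next (update r x (m (k * r a + d))) m
  | Store x a k d => State next r (update m (k * r a + d) (r x))
  | JumpIf x q => State (if r x != 0 then q else next) r m
  end.

Definition step (w : nat) (P : program) (DS : seq nat) (s : state) : state :=
  if onth P (st_pc s) is Some ins then exec w DS ins s else s.

Definition halted (P : program) (s : state) : bool := size P <= st_pc s.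

(* The query (i, l) is passed in registers 0 and 1; all other registers and
   the whole working memory are initially zero. *)
Definition init_state (i l : nat) : state :=
  State 0 (update (update (fun=> 0) 0 i) 1 l) (fun=> 0).

(* ceil (log2 sigma) *)
Definition char_bits (sigma : nat) : nat := up_log 2 sigma.

Definition packed_size (w sigma l : nat) : nat :=
  (l * char_bits sigma + w.-1) %/ w.

(* Word k of the packed representation of s, in which each character takes
   ceil (log2 sigma) bits, least significant first. *)
Definition packed_word (w sigma : nat) (s : seq 'I_sigma) (k : nat) : nat :=
  let bits :=
    \sum_(t < size s) nth 0 (map val s) t * 2 ^ (char_bits sigma * t) in
  (bits %/ 2 ^ (w * k)) %% 2 ^ w.

(* On the query (i, l), the program P run over the data structure DS halts
   within t steps with the packed representation of the length-l substring of
   T starting at i in the first cells of the working memory. *)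
Definition extracts_in (w n sigma : nat) (T : n.-tuple 'I_sigma) (P : program)
    (DS : seq nat) (i l t : nat) : Prop :=
  let final := iter t (step w P DS) (init_state i l) in
  halted P final /\
  forall k, k < packed_size w sigma l ->
    st_mem final k = packed_word w (take l (drop i T)) k.

Definition logb (R : realType) (b x : R) : R := (ln x / ln b)%R.

(* Main.v *)
Require Import Defs.
From HB Require Import structures.
From mathcomp Require Import all_boot all_order all_algebra.
From mathcomp Require Import boolp reals exp.
From mathcomp Require Import zify ring lra.

Set Implicit Arguments.
Unset Strict Implicit.
Unset Printing Implicit Defensive.

Import Order.TTheory GRing.Theory Num.Theory.

(* Let L be the integer part of log_tau (n / gamma), let a word hold cpw
   characters, and let A = cpw * L.  Level 0 of the index is T, and level k + 1
   is the virtual concatenation, over the attractor positions j, of the windows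
   T[j - 2h, j + 2h) with h = h_k = A * tau ^ (d - k).  Each level is covered by
   blocks of length 2h starting at the multiples of h, so that a factor of length
   at most A <= h lies in one block; that block has an occurrence containing some
   attractor position, hence inside one window of the next level, and a single
   pointer per block is enough to follow it.  There are d + 1 <= L + 1 levels with
   O(gamma * tau) pointers each, and the last one, of length 4 * gamma * A, is
   stored explicitly in O(gamma * L) words.  A query is cut into chunks of length
   A: following a chunk down costs O(L) and reading it costs A / cpw = L, so the
   cost per output word is constant.  When n = O(gamma * tau * A), or when
   n < gamma * tau, the packed text itself is small enough.  Consequently the
   levels are only used when they fit in fewer than n < 2 ^ w cells, and no
   address overflows. *)

(** * Packed sequences *)

Definition pack (b : nat) (f : nat -> nat) (m : nat) : nat :=
  \sum_(t < m) f t * 2 ^ (b * t).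

Lemma packD b f m k :
  pack b f (m + k) = pack b f m + 2 ^ (b * m) * pack b (fun t => f (m + t)) k.
Proof.
rewrite /pack big_split_ord /= big_distrr /=; congr (_ + _).
by apply: eq_bigr => t _; rewrite mulnDr expnD; ring.
Qed.

Lemma eq_pack b f g m : (forall t, t < m -> f t = g t) -> pack b f m = pack b g m.
Proof. by move=> fg; apply: eq_bigr => t _; rewrite fg. Qed.

Lemma pack_lt b f m : (forall t, t < m -> f t < 2 ^ b) -> pack b f m < 2 ^ (b * m).
Proof.
elim: m => [|m IHm] f_lt; first by rewrite /pack big_ord0 muln0.
rewrite /pack big_ord_recr /= -/(pack b f m) mulnS expnD.
have := IHm (fun t tm => f_lt t (ltnW tm)); have := f_lt m (leqnn _).
by move: (2 ^ b) (2 ^ (b * m)) => B M; nia.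
Qed.

(** Division drops the first [o] digits in base [2 ^ b] and reduction drops the last [r]; both are
    exact because every digit is below the base. *)
Lemma pack_slice b f o m r : (forall t, f t < 2 ^ b) ->
  (pack b f (o + m + r) %/ 2 ^ (b * o)) %% 2 ^ (b * m)
    = pack b (fun t => f (o + t)) m.
Proof.
move=> f_lt; rewrite -addnA packD addnC mulnC divnMDl ?expn_gt0 // divn_small.
  by rewrite addn0 packD addnC mulnC modnMDl modn_small ?pack_lt.
by rewrite pack_lt.
Qed.

(** * Bounded execution with an explicit list of registers *)

Section Machine.
Variables (w : nat) (P : program) (DS : seq nat).

(* Listing the registers (zero beyond the end of the list) lets the register
   file of a concrete program be updated by computation. *)
Definition within (t pc : nat) (vs : seq nat) (M : nat -> nat)
    (Q : state -> Prop) : Prop :=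
  forall r, r =1 nth 0 vs ->
  exists2 k, k <= t & Q (iter k (step w P DS) (State pc r M)).

Lemma within_step t pc vs M Q pc' vs' M' ins :
  onth P pc = Some ins ->
  (forall r, r =1 nth 0 vs -> exists2 r', r' =1 nth 0 vs' &
     exec w DS ins (State pc r M) = State pc' r' M') ->
  within t pc' vs' M' Q -> within t.+1 pc vs M Q.
Proof.
move=> Ppc step_ok H r /step_ok[r' /H[k kt Qk] E]; exists k.+1 => //.
by rewrite iterSr /step /= Ppc E.
Qed.

Lemma nth_update vs x v r :
  r =1 nth 0 vs -> update r x v =1 nth 0 (set_nth 0 vs x v).
Proof. by move=> rE y; rewrite /update nth_set_nth /= rE. Qed.

Lemma within_const t pc vs M Q x v : onth P pc = Some (Const x v) ->
  within t pc.+1 (set_nth 0 vs x (v %% 2 ^ w)) M Q -> within t.+1 pc vs M Q.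
Proof.
move=> Ppc; apply: within_step Ppc _ => r rE.
by exists (update r x (v %% 2 ^ w)); first exact: nth_update.
Qed.

Lemma within_bin t pc vs M Q o x a b : onth P pc = Some (Bin o x a b) ->
  within t pc.+1 (set_nth 0 vs x (eval_binop w o (nth 0 vs a) (nth 0 vs b))) M Q
  -> within t.+1 pc vs M Q.
Proof.
move=> Ppc; apply: within_step Ppc _ => r rE; rewrite -!rE.
by exists (update r x (eval_binop w o (r a) (r b))); first exact: nth_update.
Qed.

Lemma within_load t pc vs M Q x a k d : onth P pc = Some (LoadDS x a k d) ->
  within t pc.+1 (set_nth 0 vs x (nth 0 DS (k * nth 0 vs a + d))) M Q ->
  within t.+1 pc vs M Q.
Proof.
move=> Ppc; apply: within_step Ppc _ => r rE; rewrite -!rE.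
by exists (update r x (nth 0 DS (k * r a + d))); first exact: nth_update.
Qed.

Lemma within_store t pc vs M Q x a k d : onth P pc = Some (Store x a k d) ->
  within t pc.+1 vs (update M (k * nth 0 vs a + d) (nth 0 vs x)) Q ->
  within t.+1 pc vs M Q.
Proof.
by move=> Ppc; apply: within_step Ppc _ => r rE; exists r; rewrite //= !rE.
Qed.

Lemma within_jump t pc vs M Q x q : onth P pc = Some (JumpIf x q) ->
  within t (if nth 0 vs x != 0 then q else pc.+1) vs M Q ->
  within t.+1 pc vs M Q.
Proof.
by move=> Ppc; apply: within_step Ppc _ => r rE; exists r; rewrite //= !rE.
Qed.

Lemma within_now t pc vs M (Q : state -> Prop) :
  (forall r, Q (State pc r M)) -> within t pc vs M Q.
Proof. by move=> Qs r _; exists 0; last exact: Qs. Qed.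

Lemma within_leq t t' pc vs M Q :
  t <= t' -> within t pc vs M Q -> within t' pc vs M Q.
Proof.
by move=> tt' H r /H[k kt Qk]; exists k => //; apply: leq_trans tt'.
Qed.

End Machine.

(** * Appending to a packed output *)

(* The first [c] characters of [g] have been written: [out] full words in the
   memory [M], and the last [fill] bits in [acc]. *)
Definition written (w b : nat) (g : nat -> nat) (c fill acc out : nat)
    (M : nat -> nat) : Prop :=
  [/\ b * c = w * out + fill, fill < w, acc = pack b g c %/ 2 ^ (w * out) &
      forall k, k < out -> M k = (pack b g c %/ 2 ^ (w * k)) %% 2 ^ w].

(** When the shifted [v] overflows, the reduction modulo [2 ^ w] completes the current word, and
    [v %/ 2 ^ (w - fill)] recovers exactly the lost high bits, which start the next word. *)
Lemma written_append w b g c fill acc out M k (v := pack b (fun t => g (c + t)) k) :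
  (forall t, g t < 2 ^ b) -> b * k <= w -> written w b g c fill acc out M ->
  let acc' := (acc + (v * 2 ^ fill) %% 2 ^ w) %% 2 ^ w in
  if fill + b * k < w then written w b g (c + k) (fill + b * k) acc' out M
  else written w b g (c + k) (fill + b * k - w) (v %/ 2 ^ (w - fill)) out.+1
         (update M out acc').
Proof.
move=> g_lt kw [cE fill_lt accE ME] /=; rewrite modnDmr.
have w2 x : 0 < 2 ^ x by rewrite expn_gt0.
have acc_lt : acc < 2 ^ fill.
  by rewrite accE ltn_divLR // -expnD addnC -cE pack_lt.
have v_lt : v < 2 ^ (b * k) by rewrite pack_lt.
have packE : pack b g (c + k) = v * 2 ^ fill * 2 ^ (w * out) + pack b g c.
  by rewrite packD -/v cE expnD; ring.
have outE : pack b g (c + k) %/ 2 ^ (w * out) = acc + v * 2 ^ fill.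
  by rewrite packE divnMDl // -accE addnC.
have oldE j : j < out ->
    (pack b g (c + k) %/ 2 ^ (w * j)) %% 2 ^ w
      = (pack b g c %/ 2 ^ (w * j)) %% 2 ^ w.
  move=> j_lt; rewrite packE (_ : w * out = w * (out - j.+1) + w + w * j); last first.
    by rewrite -{1}(subnK j_lt) mulnDr mulnS addnA.
  by rewrite !expnD !mulnA divnMDl // modnMDl.
case: ifP => fits; split.
- by rewrite mulnDr cE addnA.
- by [].
- rewrite outE modn_small //; apply: (@leq_trans (2 ^ (fill + b * k))).
    by rewrite expnD; nia.
  by rewrite leq_exp2l // ltnW.
- by move=> j j_lt; rewrite ME // oldE.
- by rewrite mulnDr cE mulnS; lia.
- by lia.
- rewrite mulnSr expnD divnMA outE -{2}(subnKC (ltnW fill_lt)) expnD divnMA.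
  by rewrite addnC divnMDl // (divn_small acc_lt) addn0.
- move=> j; rewrite ltnS leq_eqVlt /update => /predU1P[->|j_lt].
    by rewrite eqxx outE.
  by rewrite ltn_eqF // ME // oldE.
Qed.

(** * The extraction program *)

(* Cells 0-6 of the data structure hold [b] (bits per character), [w],
   [cpw] (characters per word), [A] (chunk length), [h] (half the block length
   of the top level), [tau] and [S] (number of pointers per level).  The
   pointers follow, level by level, and then the explicitly stored string,
   [cpw] characters per word.

   Registers 0-9 hold the position and length of the remaining query, the
   seven parameters and the constant 1; 10-12 the state of the output (bits in
   the current word, current word, number of full words); 13-16 the position
   and remaining length of the current chunk in the current level, half the
   block length and the address of the level.  Register 20 stays 0. *)
Definition extract_prog : program :=
  [:: LoadDS 2 20 0 0;
      Bin OpEq 17 2 20;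
      JumpIf 17 60;
      LoadDS 3 20 0 1;
      LoadDS 4 20 0 2;
      LoadDS 5 20 0 3;
      LoadDS 6 20 0 4;
      LoadDS 7 20 0 5;
      LoadDS 8 20 0 6;
      Const 9 1;
      (* 10: next chunk *)
      Bin OpEq 17 1 20;
      JumpIf 17 59;
      Bin OpAdd 14 1 20;
      Bin OpLt 17 1 5;
      JumpIf 17 16;
      Bin OpAdd 14 5 20;
      Bin OpAdd 13 0 20;
      Bin OpAdd 0 0 14;
      Bin OpSub 1 1 14;
      Bin OpAdd 15 6 20;
      Bin OpAdd 16 20 20;
      (* 21: descend one level *)
      Bin OpLt 17 15 5;
      JumpIf 17 31;
      Bin OpDiv 17 13 15;
      Bin OpAdd 17 17 16;
      LoadDS 17 17 1 7;
      Bin OpMod 13 13 15;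
      Bin OpAdd 13 13 17;
      Bin OpAdd 16 16 8;
      Bin OpDiv 15 15 7;
      JumpIf 9 21;
      (* 31: copy the characters of one word *)
      Bin OpEq 17 14 20;
      JumpIf 17 10;
      Bin OpMod 18 13 4;
      Bin OpDiv 17 13 4;
      Bin OpAdd 17 17 16;
      LoadDS 17 17 1 7;
      Bin OpMul 19 18 2;
      Bin OpShr 17 17 19;
      Bin OpSub 18 4 18;
      Bin OpLt 19 18 14;
      JumpIf 19 43;
      Bin OpAdd 18 14 20;
      Bin OpMul 19 18 2;
      Bin OpShl 21 9 19;
      Bin OpMod 17 17 21;
      Bin OpAdd 13 13 18;
      Bin OpSub 14 14 18;
      Bin OpShl 21 17 10;
      Bin OpAdd 11 11 21;
      Bin OpAdd 10 10 19;
      Bin OpLt 21 10 3;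
      JumpIf 21 31;
      Store 11 12 1 0;
      Bin OpAdd 12 12 9;
      Bin OpSub 10 10 3;
      Bin OpSub 21 19 10;
      Bin OpShr 11 17 21;
      JumpIf 9 31;
      (* 59: flush *)
      Store 11 12 1 0].

Lemma sub_word w x y : x < 2 ^ w -> y <= x -> (x + 2 ^ w - y) %% 2 ^ w = x - y.
Proof.
move=> xw yx; rewrite addnC -addnBA // -[in X in X %% _](mul1n (2 ^ w)) modnMDl.
by rewrite modn_small; lia.
Qed.

(** Ensures that adding at most [w] new bits to a fill of at most [w.-1] does not wrap around. *)
Lemma double_word w : w + w.-1 < 2 ^ w.
Proof. by case: w => // w; elim: w => // w; rewrite !expnS /=; lia. Qed.

Ltac run_bin := eapply within_bin; [reflexivity | rewrite /=].
Ltac run_load := eapply within_load; [reflexivity | rewrite /= ?mul1n].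
Ltac run_jump := eapply within_jump; [reflexivity | rewrite /=].
Ltac run_store := eapply within_store; [reflexivity | rewrite /= ?mul1n ?addn0].

Section ExtractProgram.
Variables (w b cpw A tau S D n : nat) (H f X : nat -> nat) (DS : seq nat).
(** Invariant of the descent: the factor of length [m] at [p] in level [k] spells [f] from [i] on.
    Left abstract, it lets one correctness proof serve both the plain index ([D = 0]) and the
    levelled one. *)
Variable V : nat -> nat -> nat -> nat -> Prop.
Hypothesis header : take 7 DS = [:: b; w; cpw; A; H 0; tau; S].
Hypotheses (w_gt0 : 0 < w) (b_gt0 : 0 < b) (cpw_gt0 : 0 < cpw) (A_gt0 : 0 < A).
Hypotheses (word_fits : b * cpw <= w) (n_lt : n < 2 ^ w) (A_lt : A < 2 ^ w).
Hypotheses (f_lt : forall t, f t < 2 ^ b) (X_lt : forall t, X t < 2 ^ b).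
Hypotheses (H0_lt : H 0 < 2 ^ w) (H_ge : forall k, k < D -> A <= H k).
Hypothesis HS : forall k, H k.+1 = H k %/ tau.
Hypothesis H_lt : H D < A.
Hypothesis base_lt : forall k, k <= D -> k * S < 2 ^ w.
Hypothesis V_init : forall i m, i + m <= n -> V 0 i m i.
Hypothesis V_step : forall k p m i, k < D -> 0 < m <= A -> V k p m i ->
  let p' := p %% H k + nth 0 DS (p %/ H k + k * S + 7) in
  [/\ p %/ H k + k * S < 2 ^ w, p' < 2 ^ w & V k.+1 p' m i].

Definition readable (p m i : nat) : Prop :=
  [/\ p + m < 2 ^ w, forall t, t < m -> X (p + t) = f (i + t) &
      forall q, q * cpw < p + m -> q + D * S < 2 ^ w /\
        nth 0 DS (q + D * S + 7) = pack b (fun t => X (q * cpw + t)) cpw].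
Hypothesis V_readable : forall p m i, V D p m i -> readable p m i.

Local Notation run := (within w extract_prog DS).

Definition regs i l fill acc out p m h base x y z u : seq nat :=
  [:: i; l; b; w; cpw; A; H 0; tau; S; 1; fill; acc; out; p; m; h; base;
      x; y; z; 0; u].

Lemma copy_word i0 i l fill acc out p m c h x y z u M t Q
    (g := fun s => f (i0 + s)) (o := p %% cpw) (r := minn m (cpw - o)) :
  0 < m -> c + m <= n -> readable p m (i0 + c) ->
  written w b g c fill acc out M ->
  (forall fill' acc' out' x y z u M',
     written w b g (c + r) fill' acc' out' M' ->
     run t 31 (regs i l fill' acc' out' (p + r) (m - r) h (D * S) x y z u) M' Q) ->
  run (28 + t) 31 (regs i l fill acc out p m h (D * S) x y z u) M Q.
Proof.
move=> m_gt0 cm_n [pm_lt Xf words] wr K.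
have cpw_w : cpw <= w by apply: leq_trans word_fits; rewrite leq_pmull.
have w_lt : w < 2 ^ w by rewrite ltn_expl.
have o_lt : o < cpw by rewrite ltn_mod.
have r_le : r <= cpw - o by rewrite geq_minr.
have rm : r <= m by rewrite geq_minl.
have br_w : b * r <= w by apply: leq_trans word_fits; rewrite leq_mul2l; lia.
have ob_lt : o * b < w.
  by apply: (@leq_trans (b * cpw)) => //; rewrite mulnC ltn_pmul2l.
have pE : p = p %/ cpw * cpw + o by rewrite -divn_eq.
have [addr_lt wordE] : p %/ cpw + D * S < 2 ^ w /\
    nth 0 DS (p %/ cpw + D * S + 7)
      = pack b (fun t => X (p %/ cpw * cpw + t)) cpw.
  by apply: words; lia.
set v := pack b (fun s => g (c + s)) r.
have vE : (pack b (fun t => X (p %/ cpw * cpw + t)) cpw %/ 2 ^ (o * b))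
            %% (2 ^ (r * b) %% 2 ^ w) = v.
  have -> : v = pack b (fun s => X (p %/ cpw * cpw + (o + s))) r.
    apply: eq_pack => s sr; rewrite /g addnA -Xf; last by lia.
    by rewrite {1}pE !addnA.
  rewrite -(@pack_slice _ (fun s => X (p %/ cpw * cpw + s)) o r (cpw - (o + r))) //.
  rewrite subnKC; last by lia.
  rewrite ![_ * b]mulnC; case: (ltngtP (b * r) w) br_w => // [br_lt _|brE _].
    by rewrite [2 ^ _ %% _]modn_small // ltn_exp2l.
  (* A slice of exactly [w] bits makes the modulus [2 ^ w] wrap to 0. Reduction modulo 0 is the
     identity, which is right here since the word is already below [2 ^ w]. *)
  rewrite brE modnn modn0 modn_small //; apply: leq_ltn_trans (leq_div _ _) _.
  apply: leq_trans (pack_lt _) _ => [s _|]; first exact: X_lt.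
  by rewrite leq_exp2l.
have [cE fill_lt _ _] := wr.
have := double_word w => w2_lt.
have := written_append (fun s => f_lt _) br_w wr; rewrite -/v.
have rb_lt : r * b < 2 ^ w by rewrite mulnC (leq_ltn_trans br_w).
have fill_lt' : fill + r * b < 2 ^ w.
  apply: leq_ltn_trans w2_lt; rewrite addnC mulnC leq_add //.
  by rewrite -ltnS prednK.
rewrite [b * r]mulnC => wr'.
(* Both outcomes of the test at 40 (word or chunk exhausted first) meet at instruction 43 and differ
   only in register 19. *)
have K43 z' : run (16 + t) 43
    [:: i; l; b; w; cpw; A; H 0; tau; S; 1; fill; acc; out; p; m; h; D * S;
        pack b (fun t => X (p %/ cpw * cpw + t)) cpw %/ 2 ^ (o * b); r; z'; 0; u]
    M Q.
  run_bin; rewrite (modn_small rb_lt).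
  run_bin; rewrite mul1n; run_bin; rewrite vE.
  run_bin; rewrite (modn_small (leq_ltn_trans _ pm_lt)) ?leq_add2l //.
  run_bin; rewrite sub_word //; last by rewrite (leq_ltn_trans _ pm_lt) ?leq_addl.
  run_bin; run_bin; run_bin; rewrite (modn_small fill_lt').
  run_bin; run_jump; move: wr'; case: (ltnP (fill + r * b) w) => [_|full] /= wr'.
    by apply: (@within_leq _ _ _ t); [exact: (leq_addl 6 t)|exact: K].
  run_store.
  (* The word counter cannot wrap: a character has at most [w] bits, so there are no more full words
     than characters, hence at most [n]. *)
  run_bin; rewrite addn1 (modn_small (_ : out.+1 < _)); last first.
    case: wr' => cE' _ _ _; apply: leq_ltn_trans n_lt; apply: leq_trans cm_n.
    apply: (@leq_trans (c + r)); last by rewrite leq_add2l.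
    rewrite -(leq_pmul2l w_gt0); apply: (@leq_trans (b * (c + r))).
      by rewrite cE' leq_addr.
    by rewrite leq_mul2r (leq_trans _ word_fits) ?orbT // leq_pmulr.
  run_bin; rewrite sub_word //.
  run_bin; rewrite sub_word //; last by move: fill_lt; clear; lia.
  run_bin; run_jump.
  rewrite (_ : r * b - (fill + r * b - w) = w - fill); last first.
    by move: fill_lt full; clear; lia.
  exact: K.
rewrite /regs.
run_bin; run_jump; rewrite (gtn_eqF m_gt0) /=.
run_bin; rewrite -/o.
run_bin; run_bin; rewrite (modn_small addr_lt).
run_load; rewrite wordE.
run_bin; rewrite (modn_small (ltn_trans ob_lt w_lt)).
run_bin; run_bin; rewrite sub_word; [|by rewrite (leq_ltn_trans cpw_w)|exact: ltnW].
run_bin; run_jump; case: ltnP => om /=.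
  by rewrite -(minn_idPr (ltnW om)); apply: (@within_leq _ _ _ (16 + t)); [exact: leqnSn|exact: K43].
run_bin; rewrite addn0 modn_small; last by rewrite (leq_ltn_trans _ pm_lt) ?leq_addl.
by rewrite -{2}(minn_idPl om); exact: K43.
Qed.

Lemma readable_suffix p m i r :
  r <= m -> readable p m i -> readable (p + r) (m - r) (i + r).
Proof.
move=> rm; rewrite /readable -addnA subnKC // => -[? Xf words]; split => // t t_lt.
by rewrite -!addnA Xf // -(subnKC rm) ltn_add2l.
Qed.

(** [N] bounds the number of words met. After one word either the chunk is exhausted or the position
    is word-aligned, so [N - 1] words remain. *)
Lemma copy_chunk i0 i l h t Q N (g := fun s => f (i0 + s)) :
  forall fill acc out p m c x y z u M,
  p %% cpw + m <= N * cpw -> c + m <= n -> readable p m (i0 + c) ->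
  written w b g c fill acc out M ->
  (forall fill' acc' out' p' x y z u M',
     written w b g (c + m) fill' acc' out' M' ->
     run t 10 (regs i l fill' acc' out' p' 0 h (D * S) x y z u) M' Q) ->
  run (28 * N + 2 + t) 31 (regs i l fill acc out p m h (D * S) x y z u) M Q.
Proof.
have copied fill acc out p c x y z u M : written w b g c fill acc out M ->
    (forall fill' acc' out' p' x y z u M',
       written w b g c fill' acc' out' M' ->
       run t 10 (regs i l fill' acc' out' p' 0 h (D * S) x y z u) M' Q) ->
    run (2 + t) 31 (regs i l fill acc out p 0 h (D * S) x y z u) M Q.
  by move=> wr K; rewrite /regs; run_bin; run_jump; apply: K.
elim: N => [|N IHN] fill acc out p m c x y z u M pm_N cm_n rd wr K.
  have m0 : m = 0 by lia.
  by rewrite m0; apply: copied wr _ => *; apply: K; rewrite m0 addn0.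
have [m0|m_gt0] := posnP m.
  apply: (@within_leq _ _ _ (2 + t)); first by lia.
  by rewrite m0; apply: copied wr _ => *; apply: K; rewrite m0 addn0.
apply: (@within_leq _ _ _ (28 + (28 * N + 2 + t))); first by lia.
apply: (copy_word m_gt0 cm_n rd wr) => fill' acc' out' x' y' z' u' M' wr'.
have o_lt : p %% cpw < cpw by rewrite ltn_mod.
have [m_le|m_gt] := leqP m (cpw - p %% cpw).
  rewrite (minn_idPl m_le) subnn in wr' *.
  by apply: (@within_leq _ _ _ (2 + t)); [lia|apply: copied wr' K].
rewrite (minn_idPr (ltnW m_gt)) in wr' *.
apply: (IHN _ _ _ _ _ (c + (cpw - p %% cpw))) => //.
- rewrite {1}(divn_eq p cpw) -addnA subnKC ?(ltnW o_lt) // -mulSnr modnMl.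
  by rewrite mulSn in pm_N; lia.
- by lia.
- by rewrite addnA; apply: readable_suffix; rewrite // ltnW.
- by move=> *; apply: K; rewrite -(subnKC (ltnW m_gt)) addnA.
Qed.

(** The machine keeps no level counter: the loop of ten instructions exits when the half block
    length falls below [A], which first happens at level [D]. *)
Lemma descend i l fill acc out m i' y z u M t Q :
  0 < m <= A ->
  (forall p x, V D p m i' ->
     run t 31 (regs i l fill acc out p m (H D) (D * S) x y z u) M Q) ->
  forall k p x, k <= D -> V k p m i' ->
  run (10 * (D - k) + 2 + t) 21
    (regs i l fill acc out p m (H k) (k * S) x y z u) M Q.
Proof.
move=> m_bnd K k p x k_le Vk; have [e eE] : exists e, e = D - k by exists (D - k).
rewrite -eE; elim: e k p x k_le Vk eE => [|e IHe] k p x k_le Vk eE.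
  have -> : k = D by lia.
  rewrite muln0 add0n /regs; run_bin; rewrite H_lt; run_jump.
  by apply: K; rewrite (_ : D = k) //; lia.
have k_lt : k < D by lia.
apply: (@within_leq _ _ _ (10 + (10 * e + 2 + t))); first by lia.
rewrite /regs.
have [addr_lt p_lt Vk1] := V_step k_lt m_bnd Vk.
run_bin; rewrite ltnNge H_ge //; run_jump.
run_bin; run_bin; rewrite (modn_small addr_lt); run_load; run_bin.
run_bin; rewrite (modn_small p_lt); run_bin; run_bin; run_jump.
rewrite -mulSnr (modn_small (base_lt k_lt)) -HS.
by apply: IHe => //; lia.
Qed.

(** A chunk of [r] characters meets at most [r %/ cpw + 2] words, two of them possibly partial.
    Hence 71 = 6 + 5 + 2 + 2 + 28 * 2: set-up, the two loop exits and the partial words. The terms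
    [28 * (r %/ cpw)] add up to at most [28 * (l %/ cpw)]. *)
Lemma extract_chunks i0 t Q N (g := fun s => f (i0 + s)) :
  forall c l fill acc out p m h base x y z u M,
  l <= N * A -> i0 + c + l <= n -> written w b g c fill acc out M ->
  (forall i fill' acc' out' p m h base x y z u M',
     written w b g (c + l) fill' acc' out' M' ->
     run t 59 (regs i 0 fill' acc' out' p m h base x y z u) M' Q) ->
  run (N * (10 * D + 71) + 28 * (l %/ cpw) + 2 + t) 10
    (regs (i0 + c) l fill acc out p m h base x y z u) M Q.
Proof.
have extracted c fill acc out p m h base x y z u M : written w b g c fill acc out M ->
    (forall i fill' acc' out' p m h base x y z u M',
       written w b g c fill' acc' out' M' ->
       run t 59 (regs i 0 fill' acc' out' p m h base x y z u) M' Q) ->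
    run (2 + t) 10 (regs (i0 + c) 0 fill acc out p m h base x y z u) M Q.
  by move=> wr K; rewrite /regs; run_bin; run_jump; apply: K.
elim: N => [|N IHN] c l fill acc out p m h base x y z u M l_le i_le wr K.
  have l0 : l = 0 by lia.
  by rewrite l0 div0n; apply: extracted wr _ => *; apply: K; rewrite l0 addn0.
have [l0|l_gt0] := posnP l.
  apply: (@within_leq _ _ _ (2 + t)); first by rewrite -addnA leq_addl.
  by rewrite l0; apply: extracted wr _ => *; apply: K; rewrite l0 addn0.
have il_lt := leq_ltn_trans i_le n_lt.
have l_lt : l < 2 ^ w by apply: leq_ltn_trans il_lt; rewrite leq_addl.
set r := minn l A.
have r_bnd : 0 < r <= A by rewrite /r; lia.
have r_le : r <= l by rewrite /r; lia.
have K16 x' : run (N * (10 * D + 71) + 28 * ((l - r) %/ cpw) + 28 * (r %/ cpw)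
                   + 10 * D + 67 + t) 16
    [:: i0 + c; l; b; w; cpw; A; H 0; tau; S; 1; fill; acc; out; p; r; h; base;
        x'; y; z; 0; u] M Q.
  apply: (@within_leq _ _ _ (5 + (10 * (D - 0) + 2 + (28 * (r %/ cpw + 2) + 2 +
    (N * (10 * D + 71) + 28 * ((l - r) %/ cpw) + 2 + t))))); first by lia.
  run_bin; rewrite addn0 modn_small; last first.
    by apply: leq_ltn_trans il_lt; rewrite leq_addr.
  run_bin; rewrite modn_small; last first.
    by apply: leq_ltn_trans il_lt; rewrite leq_add2l.
  run_bin; rewrite sub_word //.
  run_bin; rewrite addn0 (modn_small H0_lt).
  run_bin; rewrite addn0 mod0n -(mul0n S).
  apply: descend r_bnd _ 0 _ _ _ _ => // [p' x''|]; last first.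
    by apply: V_init; lia.
  move=> /V_readable rd; apply: (copy_chunk _ _ rd wr).
  - have := ltn_pmod p' cpw_gt0; rewrite mulnDl.
    by have := ltn_ceil r cpw_gt0; rewrite mulSn; lia.
  - by lia.
  move=> fill' acc' out' p'' x1 y1 z1 u1 M' wr'; rewrite -(addnA i0 c r).
  apply: (IHN _ _ _ _ _ _ _ _ _ _ _ _ _ _ _ _ wr'); [|by lia|].
    by rewrite /r; move: l_le; rewrite mulSn; lia.
  by move=> *; apply: K; rewrite -(subnKC r_le) addnA.
apply: (@within_leq _ _ _ (6 + (N * (10 * D + 71) + 28 * ((l - r) %/ cpw)
   + 28 * (r %/ cpw) + 10 * D + 67 + t))).
  have : (l - r) %/ cpw + r %/ cpw <= l %/ cpw.
    by rewrite leq_divRL // mulnDl -{2}(subnK r_le) leq_add ?leq_divM.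
  by rewrite mulSn; lia.
rewrite /regs; run_bin; run_jump; rewrite (gtn_eqF l_gt0) /=.
run_bin; rewrite addn0 (modn_small l_lt).
run_bin; run_jump; case: (ltnP l A) => lA /=.
  rewrite -{3}(minn_idPl (ltnW lA)).
  by apply: (@within_leq _ _ _ _ _ _ _ _ _ _ (K16 _)); exact: leqnSn.
run_bin; rewrite addn0 (modn_small A_lt) -{2}(minn_idPr lA); exact: K16.
Qed.

Lemma extract_progP i0 l : i0 + l <= n ->
  exists2 t, t <= (l %/ A).+1 * (10 * D + 71) + 28 * (l %/ cpw) + 13 &
  let s := iter t (step w extract_prog DS) (init_state i0 l) in
  halted extract_prog s /\
  forall k, k < (l * b + w.-1) %/ w ->
    st_mem s k = (pack b (fun s => f (i0 + s)) l %/ 2 ^ (w * k)) %% 2 ^ w.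
Proof.
move=> il_n; pose vs := [:: i0; l; 0; 0; 0; 0; 0; 0; 0; 0; 0; 0; 0; 0; 0; 0; 0; 0; 0; 0; 0; 0].
have hd j : j < 7 -> nth 0 DS j = nth 0 [:: b; w; cpw; A; H 0; tau; S] j.
  by move=> j7; rewrite -header nth_take.
pose Q s := halted extract_prog s /\ forall k, k < (l * b + w.-1) %/ w ->
  st_mem s k = (pack b (fun s => f (i0 + s)) l %/ 2 ^ (w * k)) %% 2 ^ w.
suff: run ((l %/ A).+1 * (10 * D + 71) + 28 * (l %/ cpw) + 13) 0 vs (fun=> 0) Q.
  by apply; do 22?[case=> //] => x; rewrite /= nth_nil.
apply: (@within_leq _ _ _ (10 + ((l %/ A).+1 * (10 * D + 71) + 28 * (l %/ cpw) + 2 + 1))).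
  by lia.
rewrite /vs; run_load; rewrite hd //=.
run_bin; run_jump; rewrite (gtn_eqF b_gt0) /=.
do 6![run_load; rewrite hd //=].
eapply within_const; [reflexivity|]; rewrite /= modn_small; last first.
  by rewrite -[X in X < _](expn0 2) ltn_exp2l.
rewrite -{1}(addn0 i0).
apply: (@extract_chunks i0 1 Q (l %/ A).+1 0 l 0 0 0 0 0 0 0 _ _ _ _ (fun=> 0)).
- by rewrite ltnW // ltn_ceil.
- by rewrite addn0.
- by split; rewrite ?muln0 // /pack big_ord0 div0n.
move=> i fill acc out p m h base x y z u M [lE fill_lt accE ME].
rewrite /regs; run_store; apply: within_now => r; split => //= k k_lt.
(* At most [out.+1] words are requested, so the flushed accumulator supplies the only one not yet in
   memory. *)
have : k <= out.
  rewrite -ltnS; apply: leq_trans k_lt _; rewrite mulnC lE -addnA mulnC.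
  by rewrite divnMDl // -addn1 leq_add2l -ltnS ltn_divLR //; lia.
rewrite /update leq_eqVlt => /predU1P[->|k_lt']; last by rewrite ltn_eqF // ME.
rewrite eqxx -accE modn_small // accE ltn_divLR ?expn_gt0 // -expnD.
apply: leq_trans (pack_lt _) _ => [s _|]; first exact: f_lt.
by rewrite lE leq_exp2l // addnC leq_add2r ltnW.
Qed.

End ExtractProgram.

(** * Windows around the attractor positions *)

Section Windows.
Variables (n gamma : nat) (f J : nat -> nat).

Definition covers : Prop := forall x len, 0 < len -> x + len <= n ->
  exists t a, [/\ a < gamma, t + len <= n, t <= J a < t + len &
                  forall s, s < len -> f (t + s) = f (x + s)].

(* Level [h] of the index is the virtual concatenation over [a < gamma] of the
   windows of length [4 * h] centred at [J a].  Here its factor of length [m] at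
   [p] lies in one window and spells the characters of [f] from [i] on. *)
Definition window (h p m i : nat) : Prop :=
  exists a o u, [/\ a < gamma, p = a * (4 * h) + o, o + m <= 4 * h,
    J a + o = u + 2 * h & u + m <= n /\ forall s, s < m -> f (u + s) = f (i + s)].

Lemma window_lt h p m i : window h p m i -> p + m <= gamma * (4 * h).
Proof.
move=> [a [o [u [a_lt -> om _ _]]]].
by have := leq_mul a_lt (leqnn (4 * h)); rewrite mulSn; lia.
Qed.

Hypothesis Jcovers : covers.

(** The usable part of the block, [len] characters at offset [c], recurs at [t] around [J a]. It
    stays within [2 * h] of [J a], hence inside window [a]. The pointer is a displacement to be
    added to the offset in the block; its subtractions are exact since [J a < t + len] and
    [c + len <= 2 * h]. *)
Lemma block_pointer h x c len : 0 < len -> c + len <= 2 * h -> x + len <= n ->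
  exists2 q, q < gamma * (4 * h) & forall r m i, c <= r -> r + m <= c + len ->
    (forall s, s < m -> f (x + (r - c) + s) = f (i + s)) ->
    window h (r + q) m i.
Proof.
move=> len_gt0 len_le x_le; have [t [a [a_lt t_le Ja tx]]] := Jcovers len_gt0 x_le.
exists (a * (4 * h) + (2 * h + t - J a - c)).
  by have := leq_mul a_lt (leqnn (4 * h)); rewrite mulSn; lia.
move=> r m i cr rm xi; exists a, (r + (2 * h + t - J a - c)), (t + (r - c)).
split=> //; try lia; split; first by lia.
by move=> s sm; rewrite -xi // -addnA tx ?addnA //; lia.
Qed.

Hypothesis gamma_gt0 : 0 < gamma.

Lemma top_pointer h e : 0 < h -> exists2 q, q < gamma * (4 * h) &
  forall p m, p %/ h = e -> 0 < m <= h -> p + m <= n ->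
  window h (p %% h + q) m p.
Proof.
move=> h_gt0; have [en|en] := leqP n (e * h).
  exists 0; first by rewrite !muln_gt0 gamma_gt0.
  by move=> p m pe m_gt0 pm; have := divn_eq p h; rewrite pe; lia.
have [|||q q_lt qP] := @block_pointer h (e * h) 0 (minn (2 * h) (n - e * h)).
- by lia.
- by lia.
- by lia.
exists q => // p m pe m_le pm; have pE := divn_eq p h; rewrite pe in pE.
have := ltn_pmod p h_gt0 => p_lt; apply: qP => // [|s sm]; first by lia.
by rewrite subn0 -pE.
Qed.

Lemma level_pointer h tau e : 0 < h -> 0 < tau ->
  exists2 q, q < gamma * (4 * h) &
  forall p m i, p %/ h = e -> 0 < m <= h -> window (tau * h) p m i ->
  window h (p %% h + q) m i.
Proof.
move=> h_gt0 tau_gt0; set a := e %/ (4 * tau); set o1 := e %% (4 * tau) * h.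
pose j := J a; pose g := 2 * (tau * h); pose W := 4 * (tau * h).
(* Window lengths are multiples of [h], so [e] alone determines the window [a] where its block
   starts and the offset [o1] of that start. *)
have inside p m i : p %/ h = e -> 0 < m <= h -> window (tau * h) p m i ->
    exists u, [/\ j + (o1 + p %% h) = u + g, u + m <= n,
      o1 + p %% h + m <= W &
      forall s, s < m -> f (u + s) = f (i + s)].
  move=> pe m_le [a' [o [u [a_lt pE om Ju [um fu]]]]]; exists u.
  have W_gt0 : 0 < 4 * (tau * h) by rewrite !muln_gt0 tau_gt0.
  have o_lt : o < 4 * (tau * h) by lia.
  have pE' : p = a * (4 * (tau * h)) + (o1 + p %% h).
    rewrite {1}(divn_eq p h) pe {1}(divn_eq e (4 * tau)) -/a /o1.
    by rewrite mulnDl !mulnA addnA.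
  have o1_lt : o1 + p %% h < 4 * (tau * h).
    apply: (@leq_trans ((e %% (4 * tau)).+1 * h)).
      by rewrite mulSnr ltn_add2l ltn_mod.
    by rewrite mulnA leq_mul2r ltn_mod muln_gt0 tau_gt0 orbT.
  have aE : a' = a.
    have := congr1 (fun x => x %/ (4 * (tau * h))) pE.
    by rewrite {1}pE' !divnMDl // !divn_small // !addn0.
  have oE : o = o1 + p %% h.
    by apply/eqP; rewrite -(eqn_add2l (a * (4 * (tau * h)))) -pE' pE aE.
  by rewrite -oE /j -aE.
(* The block is clipped to the offsets inside both the window and the text: offset [o] is text
   position [j + o - g], so [g - j] marks the start of the text and [n + g - j] its end. *)
clearbody j g W o1 => {a}; pose lo := maxn o1 (g - j).
pose hi := minn (o1 + 2 * h) (minn W (n + g - j)).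
(* If nothing is left after clipping, no valid factor starts in this block and any pointer will
   do. *)
have [lohi|lohi] := leqP hi lo.
  exists 0; first by rewrite !muln_gt0 gamma_gt0.
  move=> p m i pe m_le /(inside _ _ _ pe m_le)[u [uE um om _]]; exfalso.
  move: (ltn_pmod p h_gt0) lohi uE um om m_le; rewrite /hi /lo; clear.
  by move: (p %% h) => r; lia.
have [|||q q_lt qP] := @block_pointer h (j + lo - g) (lo - o1) (hi - lo).
- by lia.
- by rewrite /hi /lo in lohi *; lia.
- by rewrite /hi /lo in lohi *; lia.
exists q => // p m i pe m_le /(inside _ _ _ pe m_le)[u [uE um om fu]].
have := ltn_pmod p h_gt0 => r_lt; move: (p %% h) uE om r_lt => r uE om r_lt.
apply: qP => [||s sm]; last rewrite -fu //; last congr (f (_ + s)).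
- by rewrite /lo; clear -uE; lia.
- by rewrite /lo /hi; clear -uE um om r_lt m_le; lia.
- by rewrite /lo; clear -uE; lia.
Qed.

End Windows.

(** * Construction of the index *)

Definition extracts_fun (w n b : nat) (f : nat -> nat) (DS : seq nat)
    (bound : nat -> nat) : Prop :=
  forall i l, i + l <= n -> exists2 t, t <= bound l &
  let s := iter t (step w extract_prog DS) (init_state i l) in
  halted extract_prog s /\
  forall k, k < (l * b + w.-1) %/ w ->
    st_mem s k = (pack b (fun s => f (i + s)) l %/ 2 ^ (w * k)) %% 2 ^ w.

Section Index.
Variables (w n b cpw : nat) (f : nat -> nat).
Hypotheses (w_gt0 : 0 < w) (b_gt0 : 0 < b) (cpw_gt0 : 0 < cpw).
Hypotheses (word_fits : b * cpw <= w) (n_gt0 : 0 < n) (n_lt : n < 2 ^ w).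
Hypothesis f_lt : forall t, f t < 2 ^ b.

Let word (X : nat -> nat) (q : nat) : nat := pack b (fun t => X (q * cpw + t)) cpw.

Let word_lt X q : (forall t, X t < 2 ^ b) -> word X q < 2 ^ w.
Proof.
move=> X_lt; apply: leq_trans (pack_lt _) _ => [t _|]; first exact: X_lt.
by rewrite leq_exp2l.
Qed.

Let small_lt x : x <= w -> x < 2 ^ w.
Proof. by move=> /leq_ltn_trans; apply; rewrite ltn_expl. Qed.

Let b_lt : b < 2 ^ w.
Proof. by apply/small_lt/(leq_trans _ word_fits); rewrite leq_pmulr. Qed.

Let cpw_lt : cpw < 2 ^ w.
Proof. by apply/small_lt/(leq_trans _ word_fits); rewrite leq_pmull. Qed.

(** With chunk length [n] and half block length 0 the descent stops at once, and the packed text is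
    read directly. *)
Lemma plain_index : exists DS,
  [/\ all (fun x => x < 2 ^ w) DS, size DS = (n %/ cpw).+1 + 7 &
      extracts_fun w n b f DS (fun l => 28 * (l %/ cpw) + 155)].
Proof.
pose hd := [:: b; w; cpw; n; 0; 0; 0].
exists (hd ++ mkseq (word f) (n %/ cpw).+1); split.
- rewrite all_cat; apply/andP; split.
    by rewrite /= b_lt small_lt // cpw_lt n_lt !expn_gt0.
  by apply/allP => _ /mapP[q _ ->]; apply: word_lt.
- by rewrite size_cat size_mkseq addnC.
move=> i l il_n.
have [||||||||| t t_le tP] := @extract_progP w b cpw n 0 0 0 n (fun=> 0) f f
  (hd ++ mkseq (word f) (n %/ cpw).+1) (fun _ p m j => p = j /\ j + m <= n)
  _ w_gt0 b_gt0 cpw_gt0 n_gt0 word_fits n_lt n_lt f_lt f_lt _ _ _ _ _ _ _ _ i l il_n.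
- by rewrite take_size_cat.
- by rewrite expn_gt0.
- by [].
- by move=> k; rewrite divn0.
- by [].
- by move=> k _; rewrite muln0 expn_gt0.
- by [].
- by [].
- move=> p m j [-> jm_n]; split=> // [|q q_lt]; first exact: leq_ltn_trans n_lt.
  have q_le : q <= n %/ cpw.
    by rewrite leq_divRL // ltnW // (leq_trans q_lt).
  split.
    rewrite muln0 addn0; apply: leq_ltn_trans n_lt; apply: leq_trans q_le _.
    exact: leq_div.
  rewrite muln0 addn0 nth_cat /= ltnNge leq_addl /= addnK.
  by rewrite (nth_mkseq 0 (word f)).
exists t => //; apply: leq_trans t_le _.
(* This allows for two chunks at most, and 155 = 2 * 71 + 13. *)
have : l %/ n <= 1.
  by rewrite -ltnS ltn_divLR // mulSn; lia.
by nia.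
Qed.

Variables (gamma tau L : nat) (J : nat -> nat).
Hypotheses (gamma_gt0 : 0 < gamma) (tau_gt1 : 1 < tau) (L_gt0 : 0 < L).
Hypothesis Jcovers : covers n gamma f J.
Hypothesis long : 18 * (gamma * tau * (cpw * L)) <= n.
Hypothesis few_levels : n < gamma * tau ^ L.+1.

Lemma levelled_index : exists DS,
  [/\ all (fun x => x < 2 ^ w) DS, size DS <= 18 * (gamma * tau * L) + 7 &
      extracts_fun w n b f DS (fun l => 119 * (L + l %/ cpw) + 155)].
Proof.
have [A AE] : exists A, A = cpw * L by exists (cpw * L).
have A_gt0 : 0 < A by rewrite AE muln_gt0 cpw_gt0.
have longA := long; rewrite -AE in longA.
have tau_gt0 : 0 < tau by apply: ltnW.
have tauX_gt0 k : 0 < tau ^ k by rewrite expn_gt0 tau_gt0.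
have gA_gt0 : 0 < 8 * (gamma * A) by rewrite !muln_gt0 gamma_gt0 A_gt0.
(* The largest [d] with [8 * gamma * A * tau ^ d <= n]: every windowed level then fits in [n]
   positions, while maximality leaves fewer than [8 * gamma * tau] blocks at the top. *)
pose d := trunc_log tau (n %/ (8 * (gamma * A))).
have /andP[d_le d_gt] : tau ^ d <= n %/ (8 * (gamma * A)) < tau ^ d.+1.
  apply: trunc_log_bounds => //; rewrite divn_gt0 //; apply: leq_trans longA.
  by rewrite leq_mul // -mulnA leq_mul2l leq_pmull ?orbT.
rewrite leq_divRL // in d_le; rewrite ltn_divLR // in d_gt.
have dL : d <= L.
  rewrite -ltnS -(ltn_exp2l _ _ tau_gt1) -(ltn_pmul2l gamma_gt0).
  apply: leq_ltn_trans few_levels; apply: leq_trans d_le.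
  by rewrite mulnC leq_mul2l mulnCA leq_pmulr ?orbT // muln_gt0.
pose H k := A * tau ^ d %/ tau ^ k.
have HE k : k <= d -> H k = A * tau ^ (d - k).
  by move=> kd; rewrite /H -{1}(subnK kd) expnD mulnA mulnK.
have H0 : H 0 = A * tau ^ d by rewrite HE // subn0.
have H_ge k : k < d.+1 -> A <= H k by rewrite ltnS => kd; rewrite HE // leq_pmulr.
have H_gt0 k : k < d.+1 -> 0 < H k by move=> /H_ge; apply: leq_trans.
have H_le k : H k <= H 0.
  by rewrite /H expn0 divn1 leq_div.
have HS k : H k.+1 = H k %/ tau by rewrite /H expnSr divnMA.
have H_prev k : k < d -> H k = tau * H k.+1.
  by move=> kd; rewrite !HE // 1?ltnW // mulnCA -expnS subnSK.
have Hd : H d = A by rewrite HE // subnn muln1.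
have H_lt : H d.+1 < A by rewrite HS Hd ltn_Pdiv.
have gH0_le : 8 * (gamma * H 0) <= n.
  by rewrite H0 mulnA [8 * _ * _]mulnA -[8 * _ * _]mulnA mulnC.
have window_fits k : gamma * (4 * H k) <= n.
  by apply: leq_trans gH0_le; rewrite mulnCA leq_mul // leq_mul2l H_le orbT.
(* A lower level has only [4 * gamma * tau] blocks, so [S] suffices at every level. The last string
   has [4 * gamma * cpw * L] characters, that is, [E] words. *)
pose S := 8 * (gamma * tau); pose D := d.+1; pose E := 4 * (gamma * L).
have S_gt0 : 0 < S by rewrite !muln_gt0 gamma_gt0.
(* Here [D <= L + 1 <= 2 * L] gives 16, and [tau >= 2] turns the 4 of [E] into 2. *)
have size_le : D * S + E <= 18 * (gamma * tau * L).
  have : gamma * L <= gamma * tau * L.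
    by rewrite mulnAC leq_pmulr.
  have : D * S <= 2 * L * S by rewrite leq_mul2r /D; lia.
  by rewrite /S /E; nia.
have size_lt : D * S + E <= n.
  apply: leq_trans long; apply: leq_trans size_le _.
  by rewrite !leq_mul2l leq_pmull ?orbT.
pose V k p m i := if k is k'.+1 then window n gamma f J (H k') p m i
                  else p = i /\ i + m <= n.
(* The guard [ke.1 < D] sits under the existential so that [choice] yields a total table. *)
have ptrs (ke : nat * nat) : exists q, ke.1 < D ->
    q < n /\ forall p m i, p %/ H ke.1 = ke.2 -> 0 < m <= A ->
    V ke.1 p m i -> V ke.1.+1 (p %% H ke.1 + q) m i.
  case: ke => k e /=; have [kD|kD] := boolP (k < D); last first.
    by exists 0 => kD'; case/negP: kD.
  have m_le m : 0 < m <= A -> 0 < m <= H k.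
    by move=> /andP[-> mA]; apply: leq_trans mA (H_ge _ kD).
  case: k kD m_le => [|k] kD m_le.
    have [q q_lt qP] := top_pointer Jcovers gamma_gt0 e (H_gt0 _ kD).
    exists q => _; split; first exact: leq_trans q_lt (window_fits _).
    by move=> p m i pe /m_le m_bnd [<- pm]; apply: qP.
  have [q q_lt qP] := level_pointer Jcovers gamma_gt0 e (H_gt0 _ kD) tau_gt0.
  exists q => _; split; first exact: leq_trans q_lt (window_fits _).
  by move=> p m i pe /m_le m_bnd; rewrite /V H_prev //; apply: qP.
have [tab tabP] := choice ptrs.
(* Where a window sticks out of the text this value is arbitrary; a valid [window] factor never
   covers such a position. *)
pose X p := f (J (p %/ (4 * A)) + p %% (4 * A) - 2 * A).
pose cell a := if a < D * S then tab (a %/ S, a %% S) else word X (a - D * S).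
pose hd := [:: b; w; cpw; A; H 0; tau; S].
pose DS := hd ++ mkseq cell (D * S + E).
have DSE a : a < D * S + E -> nth 0 DS (a + 7) = cell a.
  move=> a_lt; rewrite /DS nth_cat ltnNge leq_addl /= addnK.
  by rewrite nth_mkseq.
have X_lt t : X t < 2 ^ b by apply: f_lt.
have S_le : S <= D * S by rewrite leq_pmull.
have below_n x : x <= n -> x < 2 ^ w by move=> x_le; apply: leq_ltn_trans n_lt.
have A_lt : A < 2 ^ w.
  by apply/below_n/(leq_trans _ (window_fits d)); rewrite Hd mulnA leq_pmull ?muln_gt0 ?gamma_gt0.
have H0_lt : H 0 < 2 ^ w.
  by apply/below_n/(leq_trans _ gH0_le); rewrite mulnA leq_pmull ?muln_gt0.
have DS_n : D * S <= n := leq_trans (leq_addr _ _) size_lt.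
have S_lt : S < 2 ^ w by apply: below_n; apply: leq_trans S_le DS_n.
have tau_lt : tau < 2 ^ w.
  by apply: leq_ltn_trans S_lt; rewrite /S mulnA leq_pmull ?muln_gt0.
exists DS; split.
- rewrite all_cat; apply/andP; split.
    by rewrite /= b_lt small_lt // cpw_lt A_lt H0_lt tau_lt S_lt.
  apply/allP => _ /mapP[a _ ->]; rewrite /cell; case: ifP => a_lt; last exact: word_lt.
  have [|? _] := tabP (a %/ S, a %% S); first by rewrite ltn_divLR.
  by apply/below_n/ltnW.
- by rewrite size_cat size_mkseq addnC leq_add2r.
move=> i l il_n.
have [||||| t t_le tP] := @extract_progP w b cpw A tau S D n H f X DS V
  _ w_gt0 b_gt0 cpw_gt0 A_gt0 word_fits n_lt A_lt f_lt X_lt H0_lt H_ge HS H_lt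
  _ _ _ _ i l il_n.
- by rewrite take_size_cat.
- move=> k kD; apply: below_n; apply: leq_trans DS_n.
  by rewrite leq_mul2r kD orbT.
- by [].
- move=> k p m j kD m_bnd Vk p'.
  have e_lt : p %/ H k < S.
    rewrite ltn_divLR ?H_gt0 //; case: k kD Vk @p' => [|k] kD Vk _.
      case: Vk => -> jm_n; apply: (@leq_trans n); first by lia.
      by rewrite ltnW // (leq_trans d_gt) // H0 /S expnS; lia.
    have := window_lt Vk; rewrite H_prev // => pm_le.
    apply: (@leq_trans (p + m)); first by lia.
    by apply: leq_trans pm_le _; rewrite /S; lia.
  have a_lt : p %/ H k + k * S < D * S.
    by apply: (@leq_trans (k.+1 * S)); rewrite ?leq_mul2r ?kD ?orbT // mulSn ltn_add2r.
  have tabE : nth 0 DS (p %/ H k + k * S + 7) = tab (k, p %/ H k).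
    rewrite DSE; last exact: leq_trans a_lt (leq_addr _ _).
    by rewrite /cell a_lt addnC divnMDl // modnMDl divn_small // modn_small // addn0.
  have Vk1 : V k.+1 p' m j.
    by rewrite /p' tabE; have [_] := tabP (k, p %/ H k) kD; apply.
  split=> //; first by apply/below_n/(leq_trans (ltnW a_lt)).
  apply/below_n/(leq_trans _ (window_fits k))/(leq_trans _ (window_lt Vk1)).
  exact: leq_addr.
- move=> p m j; rewrite /V /D Hd => win; have := window_lt win => pm_le.
  have pm_n : p + m <= n by apply: leq_trans pm_le _; rewrite -Hd.
  split=> [|t tm|q q_lt]; first exact: below_n.
    case: win => a [o [u [a_lt pE om Ju [_ fu]]]].
    rewrite -fu // /X pE -addnA divnMDl; last by lia.
    rewrite modnMDl divn_small; last by lia.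
    by rewrite modn_small; last (by lia); congr f; rewrite addn0; lia.
  have q_E : q < E.
    rewrite -(ltn_pmul2r cpw_gt0); apply: leq_trans q_lt _.
    by apply: leq_trans pm_le _; rewrite AE /E; lia.
  split; first by apply/below_n/(leq_trans _ size_lt); rewrite addnC leq_add2l ltnW.
  rewrite DSE; last by rewrite addnC ltn_add2l.
  by rewrite /cell ltnNge leq_addl /= addnK.
exists t => //; apply: leq_trans t_le _.
(* A full chunk fills [L] output words, which pay for its descent. The constant 119 is 91 per chunk
   and level plus 28 for copying. *)
have lAL : l %/ A * L <= l %/ cpw.
  by rewrite leq_divRL // -mulnA [L * _]mulnC -AE leq_divM.
have D_le : 10 * D + 71 <= 91 * L by rewrite /D; lia.
have := leq_mul (leqnn (l %/ A).+1) D_le; rewrite mulnCA [_.+1 * L]mulSn.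
move: lAL; move: (l %/ A * L) ((l %/ A).+1 * _) (l %/ cpw) => x y z; clear; lia.
Qed.

End Index.

(** * From string attractors to the index *)

Definition char_at (n sigma : nat) (T : n.-tuple 'I_sigma) : nat -> nat :=
  nth 0 (map val T).

Lemma char_at_lt n sigma (T : n.-tuple 'I_sigma) t :
  char_at T t < 2 ^ char_bits sigma.
Proof.
rewrite /char_at; have [t_lt|t_ge] := ltnP t (size (map val T)).
  have /mapP[c _ ->] := mem_nth 0 t_lt.
  exact: leq_trans (ltn_ord c) (up_logP _ _).
by rewrite nth_default // expn_gt0.
Qed.

Lemma string_attractor_covers n sigma (T : n.-tuple 'I_sigma)
    (Gamma : {set 'I_n}) :
  string_attractor T Gamma ->
  covers n #|Gamma| (char_at T) (nth 0 (map val (enum Gamma))).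
Proof.
move=> attr x len len_gt0 x_le.
have x_lt : x < n by lia.
have y_lt : x + len.-1 < n by lia.
have [|i [j [ij subE [p pG ipj]]]] := attr (Ordinal x_lt) (Ordinal y_lt).
  by rewrite /= leq_addr.
rewrite /substring /= addKn prednK // in subE.
(* [substring] truncates at the end of the text, but neither side reaches past it, so equality
   forces equal lengths. *)
have ji_len : (j - i).+1 = len.
  have := congr1 size subE; rewrite !size_take_min !size_drop size_tuple.
  by have := ltn_ord j; lia.
exists i, (index p (enum Gamma)); split.
- by rewrite cardE index_mem mem_enum.
- by have := ltn_ord j; lia.
- rewrite (nth_map p) ?index_mem ?mem_enum // nth_index ?mem_enum //.
  by rewrite -ji_len addnS ltnS subnKC.
move=> s s_lt; rewrite ji_len in subE.
have := congr1 (fun u => nth 0 (map val u) s) subE.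
by rewrite /= !map_take !map_drop !nth_take // !nth_drop.
Qed.

Lemma packed_wordE w n sigma (T : n.-tuple 'I_sigma) i l k : i + l <= n ->
  packed_word w (take l (drop i T)) k =
  (pack (char_bits sigma) (fun s => char_at T (i + s)) l %/ 2 ^ (w * k)) %% 2 ^ w.
Proof.
move=> il_n; rewrite /packed_word -/(pack _ _ _); congr ((_ %/ _) %% _).
have -> : size (take l (drop i T)) = l.
  by rewrite size_takel // size_drop size_tuple; lia.
by apply: eq_pack => t t_lt; rewrite map_take map_drop nth_take // nth_drop.
Qed.

(** The disjunction isolates [L = 0], that is [n < gamma * tau], where a bound proportional to [L]
    would be constant; the real logarithm handles that case later. *)
Lemma attractor_index w n sigma (T : n.-tuple 'I_sigma) (Gamma : {set 'I_n}) tau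
    (gamma := #|Gamma|) (L := trunc_log tau (n %/ gamma))
    (cpw := w %/ char_bits sigma) :
  0 < n -> n < 2 ^ w -> sigma <= 2 ^ w -> 0 < char_bits sigma ->
  string_attractor T Gamma -> 1 < tau -> 0 < gamma -> exists DS,
  [/\ all (fun x => x < 2 ^ w) DS,
      size DS <= 18 * (gamma * tau * L) + 7 \/
        n < gamma * tau /\ size DS <= n + 8 &
      extracts_fun w n (char_bits sigma) (char_at T) DS
        (fun l => 119 * (L + l %/ cpw) + 155)].
Proof.
move=> n_gt0 n_lt sigma_le b_gt0 /string_attractor_covers cov tau_gt1 gamma_gt0.
have b_le : char_bits sigma <= w by apply: up_log_min.
have cpw_gt0 : 0 < cpw by rewrite divn_gt0.
have w_gt0 : 0 < w by apply: leq_trans b_le.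
have fits : char_bits sigma * cpw <= w by rewrite mulnC leq_divM.
have gamma_le : gamma <= n by rewrite -[n in _ <= n]card_ord max_card.
have /andP[_ L_gt] : tau ^ L <= n %/ gamma < tau ^ L.+1.
  by apply: trunc_log_bounds; rewrite // divn_gt0.
rewrite ltn_divLR // mulnC in L_gt.
have [DS [DS_lt DSE ext]] := plain_index w_gt0 b_gt0 cpw_gt0 fits n_gt0 n_lt
  (char_at_lt T).
have plain : extracts_fun w n (char_bits sigma) (char_at T) DS
    (fun l => 119 * (L + l %/ cpw) + 155).
  move=> i l /ext[t t_le tP]; exists t => //; apply: leq_trans t_le _.
  by rewrite leq_add2r leq_mul // leq_addl.
have [L0|L_gt0] := posnP L.
  exists DS; split=> //; right; split; first by rewrite L0 expn1 in L_gt.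
  by rewrite DSE addSnnS leq_add2r leq_div.
have [long|short] := leqP (18 * (gamma * tau * (cpw * L))) n.
  have [DS' [? ? ?]] := levelled_index w_gt0 b_gt0 cpw_gt0 fits n_gt0 n_lt
    (char_at_lt T) gamma_gt0 tau_gt1 L_gt0 cov long L_gt.
  by exists DS'; split=> //; left.
exists DS; split=> //; left; rewrite DSE leq_add2r ltn_divLR //.
by rewrite -!mulnA [L * _]mulnC mulnA in short *.
Qed.

(** * Bounds in terms of real logarithms *)

Local Open Scope ring_scope.

Section Bounds.
Variable R : realType.
Implicit Types (x t : R).

Lemma natr_leq_logb (k b : nat) x :
  (1 < b)%N -> (b ^ k)%:R <= x -> k%:R <= logb b%:R x.
Proof.
move=> b_gt1 bk_le; have b_gt0 : (0 < b)%N by apply: ltnW.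
have lnb_gt0 : 0 < ln (b%:R : R) by rewrite ln_gt0 // ltr1n.
have bk_gt0 : 0 < (b ^ k)%:R :> R by rewrite ltr0n expn_gt0 b_gt0.
rewrite /logb ler_pdivlMr // mulr_natl -lnXn ?ltr0n // -natrX.
by rewrite ler_ln ?posrE // (lt_le_trans bk_gt0).
Qed.

Lemma char_bits_le (sigma : nat) : (1 < sigma)%N ->
  (char_bits sigma)%:R <= 2 * logb 2 sigma%:R :> R.
Proof.
move=> sigma_gt1.
have lg1 : 1 <= logb 2 sigma%:R :> R.
  by apply: (@natr_leq_logb 1 2) => //; rewrite ler_nat.
have /andP[/ltnW b_lt _] := @up_log_bounds 2 sigma isT sigma_gt1.
have := @natr_leq_logb _ 2 sigma%:R isT; move/(_ (up_log 2 sigma).-1).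
rewrite ler_nat => /(_ b_lt) lg.
have b_gt0 : (0 < up_log 2 sigma)%N by rewrite up_log_gt0.
by rewrite /char_bits -(prednK b_gt0) -natr1; lra.
Qed.

Lemma ln2_ge_half : 1 / 2 <= ln 2 :> R.
Proof.
have := @le_ln1Dx R (- (1 / 2)) ltac:(lra).
by rewrite (_ : 1 + - (1 / 2) = 2^-1); [rewrite lnV ?posrE; lra | lra].
Qed.

(** Used with [x = n / gamma] and [t = tau] to bound the plain index when [n < gamma * tau]. For
    [x > 2], [ln t <= ln x + t / x] gives [x * ln t <= x * ln x + t], and [x <= t] with
    [ln x >= 1 / 2] bounds this by [3 * t * ln x]. *)
Lemma le_mul_logb x t : 1 <= x -> x <= t -> 2 <= t ->
  x <= 3 * (t * logb t x + 1).
Proof.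
move=> x_ge1 xt t_ge2; have lnt_gt0 : 0 < ln t by rewrite ln_gt0 //; lra.
have lnx_ge0 : 0 <= ln x by rewrite ln_ge0.
have lg_ge0 : 0 <= t * logb t x.
  by rewrite mulr_ge0 ?divr_ge0 ?(ltW lnt_gt0) //; lra.
have [x_le2|x_gt2] := lerP x 2; first by lra.
suff : x <= 3 * (t * logb t x) by lra.
have lnx : 1 / 2 <= ln x.
  by apply: le_trans ln2_ge_half _; rewrite ler_ln ?posrE //; lra.
have x_neq0 : x != 0 by rewrite gt_eqF //; lra.
have lnt : ln t <= ln x + t / x.
  rewrite -{1}(divfK x_neq0 t) lnM ?posrE ?divr_gt0 //; try lra.
  rewrite addrC lerD2l ltW // ln_sublinear // divr_gt0 //; lra.
rewrite /logb !mulrA ler_pdivlMr //.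
have : x * ln t <= x * ln x + t.
  have /(_ x) := ler_wpM2l _ lnt; rewrite mulrDr mulrCA divff // mulr1.
  by apply; lra.
by nra.
Qed.

End Bounds.

Theorem theorem5p3 (R : realType) :
  exists (P : program) (c : R),
  forall (w n sigma : nat) (T : n.-tuple 'I_sigma) (Gamma : {set 'I_n})
    (tau : nat),
  (0 < n)%N -> (n < 2 ^ w)%N -> (sigma <= 2 ^ w)%N ->
  string_attractor T Gamma -> (2 <= tau)%N ->
  let gamma : R := #|Gamma|%:R in
  let levels : R := logb tau%:R (n%:R / gamma) in
  exists DS : seq nat,
  [/\ all (fun x => x < 2 ^ w)%N DS,
      (size DS)%:R <= c * (gamma * tau%:R * levels + gamma) &
      forall i l : nat, (i + l <= n)%N ->
      exists2 t : nat,
        t%:R <= c * (levels + l%:R * logb 2 sigma%:R / w%:R + 1) &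
        extracts_in w T P DS i l t].
Proof.
(* 476 = 4 * 119, the factor 4 coming from the conversion of [l %/ cpw] to real logarithms. *)
exists extract_prog, 476 => w n sigma T Gamma tau n_gt0 n_lt sigma_le attr tau_gt1.
move=> gamma levels.
have Gamma_gt0 : (0 < #|Gamma|)%N.
  have [|i [j [_ _ [p pG _]]]] := attr (Ordinal n_gt0) (Ordinal n_gt0); first by [].
  by apply/card_gt0P; exists p.
have gamma_ge1 : 1 <= gamma by rewrite ler1n.
have gamma_gt0 : 0 < gamma by lra.
have tau_ge2 : 2 <= tau%:R :> R by rewrite ler_nat.
have Gamma_le : (#|Gamma| <= n)%N by rewrite -[n in (_ <= n)%N]card_ord max_card.
have ratio_ge1 : 1 <= n%:R / gamma by rewrite ler_pdivlMr // mul1r ler_nat.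
have levels_ge0 : 0 <= levels by apply: (@natr_leq_logb R 0 tau).
have gtl_ge0 : 0 <= gamma * tau%:R * levels by rewrite mulr_ge0 // mulr_ge0 ?ler0n ?(ltW gamma_gt0).
have w_gt0 : (0 < w)%N by case: (w) n_lt n_gt0 => //; rewrite expn0; lia.
have sigma_gt0 : (0 < sigma)%N by case: (tnth T (Ordinal n_gt0)) => c; lia.
have lg_ge0 : 0 <= logb 2 sigma%:R :> R by apply: (@natr_leq_logb R 0 2) => //; rewrite ler1n.
have lw_ge0 (l : nat) : 0 <= l%:R * logb 2 sigma%:R / w%:R :> R.
  by rewrite divr_ge0 ?ler0n // mulr_ge0 ?ler0n.
(* For a unary alphabet no output is due: on the empty structure the first load returns the default
   0, and the program jumps past its end in three steps. *)
have [b0|b_gt0] := posnP (char_bits sigma).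
  exists [::]; split=> //=; first by rewrite mulr_ge0 ?addr_ge0 // ltW.
  move=> i l _; exists 3%N; first by have := lw_ge0 l; lra.
  by split=> // k; rewrite /packed_size b0 muln0 add0n divn_small ?ltn_predL.
have sigma_gt1 : (1 < sigma)%N by rewrite up_log_gt0 in b_gt0.
have [DS [DS_lt DS_size ext]] :=
  attractor_index n_gt0 n_lt sigma_le b_gt0 attr tau_gt1 Gamma_gt0.
set L := trunc_log tau (n %/ #|Gamma|) in DS_size ext.
have L_le : L%:R <= levels.
  apply: natr_leq_logb => //; rewrite ler_pdivlMr // -natrM ler_nat.
  by rewrite -leq_divRL // trunc_logP // divn_gt0.
exists DS; split=> // [|i l il_n].
  case: DS_size => [size_le|[n_small size_le]].
    have : (size DS)%:R <= 18 * (gamma * tau%:R * L%:R) + 7 :> R.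
      by rewrite -!natrM -natrD ler_nat.
    have : gamma * tau%:R * L%:R <= gamma * tau%:R * levels.
      by rewrite ler_wpM2l // mulr_ge0 ?ler0n ?(ltW gamma_gt0).
    by lra.
  have : (size DS)%:R <= n%:R + 8 :> R by rewrite -natrD ler_nat.
  have : n%:R / gamma <= tau%:R.
    by rewrite ler_pdivrMr // -natrM ler_nat mulnC ltnW.
  move=> /(le_mul_logb ratio_ge1)/(_ tau_ge2); rewrite -/levels ler_pdivrMr //.
  by lra.
have [t t_le [t_halt t_mem]] := ext i l il_n; exists t; last first.
  by split=> // k k_lt; rewrite packed_wordE // t_mem.
have : t%:R <= 119 * (L%:R + (l %/ (w %/ char_bits sigma))%:R) + 155 :> R.
  by rewrite -natrD -natrM -natrD ler_nat.
(* One factor 2 is lost by rounding [w / b] down, the other by rounding [log sigma] up. *)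
have : (l %/ (w %/ char_bits sigma))%:R <= 4 * (l%:R * logb 2 sigma%:R / w%:R) :> R.
  rewrite mulrA ler_pdivlMr ?ltr0n //.
  have b_le : (char_bits sigma <= w)%N by apply: up_log_min.
  have cpw_gt0 : (0 < w %/ char_bits sigma)%N by rewrite divn_gt0.
  have word_le : (w <= 2 * (w %/ char_bits sigma) * char_bits sigma)%N.
    apply: leq_trans (ltnW (ltn_ceil w b_gt0)) _.
    by rewrite leq_mul2r mul2n -addnn -addn1 leq_add2l cpw_gt0 orbT.
  have : (l %/ (w %/ char_bits sigma) * w <= 2 * (l * char_bits sigma))%N.
    apply: leq_trans (leq_mul (leqnn _) word_le) _.
    by rewrite !mulnA [(_ * 2)%N]mulnC -!mulnA leq_mul2l mulnA leq_mul2r leq_divM orbT.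
  rewrite -(ler_nat R) !natrM => /le_trans; apply.
  have := ler_wpM2l (ler0n R l) (char_bits_le R sigma_gt1).
  by lra.
by have := lw_ge0 l; lra.
Qed.
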